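(* Let $\theta\in L^1(0,T)$ for every $T>0$ and suppose that $$\theta(t)+k\int_0^t\theta(\tau)\,d\tau\le\int_s^tf(\tau)\,d\tau+\theta(s)+k\int_0^s\theta(\tau)\,d\tau\qquad(\ast)$$ holds for a.e. $t,s\in(0,\infty)$ with $t\ge s$, where $f\in L^1(0,T)$ for every $T>0$ and the constant $k\ge0$ are given. Then $$\theta(t)\le\theta(s)e^{-k(t-s)}+\int_s^te^{-k(t-\tau)}f(\tau)\,d\tau\qquad(\ast\ast)$$ for a.e. $t,s\in(0,\infty)$ with $t\ge s$. Furthermore, suppose $\theta:[0,\infty)\to\mathbb{R}$ is a lower semicontinuous representative satisfying $(\ast)$ for a.e. $t,s\in(0,\infty)$ with $t\ge s$. Then $(\ast)$ and $(\ast\ast)$ also hold for every $t\ge s$ and for a.e. $s>0$; and if, in addition, $(\ast)$ holds for $s=0$ (and all $t\ge 0$), then $$\theta(t)\le\theta(0)e^{-kt}+\int_0^te^{-k(t-\tau)}f(\tau)\,d\tau\qquad\text{for all }t\in[0,\infty).$$ In particular (under all the preceding assumptions, with $\theta$ lower semicontinuous and $(\ast)$ also holding for $s=0$, and with $k>0$ so that the bound below is defined), suppose $f(t)=l+g(t)$, where $l\in\mathbb{R}$ is a given constant and $g\in L^1_{tb}(0,\infty)$. Then $$\theta(t)\le\theta(0)e^{-kt}+\frac{l}{k}+\frac{\|g\|_{L^1_{tb}}}{1-e^{-k}}\qquad\text{for all }t\in[0,\infty).$$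
   Context: $g\in L^1_{tb}(0,\infty)$ means that $g\in L^1_{loc}([0,\infty))$ and $g$ is translation bounded, that is, $\|g\|_{L^1_{tb}}:=\sup_{t\ge0}\int_t^{t+1}|g(\tau)|\,d\tau<\infty$.
   Formalization: In the last bound the constant l is assumed nonnegative; for l < 0 the bound as stated can fail, e.g. k = 1, θ = f = l = −1, g = 0 at t = 0. *)

(* Defs.v *)
From HB Require Import structures.
From mathcomp Require Import all_boot all_order all_algebra.
From mathcomp Require Import all_classical all_reals all_analysis.
Import Order.TTheory GRing.Theory Num.Theory.
Import numFieldNormedType.Exports.

Set Implicit Arguments.
Unset Strict Implicit.
Unset Printing Implicit Defensive.

Local Open Scope classical_set_scope.
Local Open Scope ring_scope.

(* Functions on (0, oo) or [0, oo) are represented by total functions R -> R;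
   values on the negative half-line are never used. *)

Definition L1_finite_intervals (R : realType) (h : R -> R) : Prop :=
  forall T : R, 0 < T -> lebesgue_measure.-integrable `]0, T[ (EFin \o h).

(* [locally_integrable] of the library only covers open domains. *)
Definition L1_loc_half_line (R : realType) (h : R -> R) : Prop :=
  forall K : set R, K `<=` `[0, +oo[ -> compact K ->
    lebesgue_measure.-integrable K (EFin \o h).

Definition L1_tb_norm (R : realType) (h : R -> R) : \bar R :=
  ereal_sup [set (\int[lebesgue_measure]_(x in `[t, (t + 1)%R]) `|h x|%:E)%E
            | t in `[0, +oo[].

Definition L1_tb (R : realType) (h : R -> R) : Prop :=
  L1_loc_half_line h /\ (L1_tb_norm h < +oo)%E.

Definition integral_ineq (R : realType) (k : R) (theta f : R -> R) (t s : R)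
    : Prop :=
  theta t + k * \int[lebesgue_measure]_(x in `[0, t]) theta x
  <= (\int[lebesgue_measure]_(x in `[s, t]) f x)
     + theta s + k * \int[lebesgue_measure]_(x in `[0, s]) theta x.

Definition gronwall_ineq (R : realType) (k : R) (theta f : R -> R) (t s : R)
    : Prop :=
  theta t <= theta s * expR (- k * (t - s))
    + \int[lebesgue_measure]_(x in `[s, t]) (expR (- k * (t - x)) * f x).

(* "P t s for a.e. t, s in (0, oo) with s <= t": almost every pair (t, s) for
   the two-dimensional Lebesgue measure. *)
Definition ae_ordered_pairs (R : realType) (P : R -> R -> Prop) : Prop :=
  {ae (@lebesgue_measure R \x @lebesgue_measure R)%E,
    forall p : R * R, 0 < p.2 -> p.2 <= p.1 -> P p.1 p.2}.

Definition every_t_ae_s (R : realType) (P : R -> R -> Prop) : Prop :=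
  {ae @lebesgue_measure R,
    forall s : R, 0 < s -> forall t : R, s <= t -> P t s}.

(* The subspace topology makes this lower semicontinuity of the restriction of
   h to [0, oo): one-sided at 0, and no condition at negative points. *)
Definition lsc_half_line (R : realType) (h : R -> R) : Prop :=
  lower_semicontinuous (EFin \o h : subspace `[0, +oo[%classic -> \bar R).

(* Main.v *)
(** Put [h := f - k theta].  The hypothesis says
    [theta t <= theta x + int_[x, t] h] for almost every [x < t].  Integrating
    it in [x] over [[s, t]] against [k e^(k x) dx] and adding [e^(k s)] times the
    inequality at [x = s], Fubini turns the double integral of [h] into a single
    one, the terms in [theta x] cancel, and
    [e^(k t) theta t <= e^(k s) theta s + int_[s, t] e^(k x) f x] remains.  With
    lower semicontinuity, the hypothesis extends to every [t >= s] by letting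
    good points decrease to [t].  The last bound is an induction over windows of
    length 1: [J t := int_[0, t] e^(k x) |g x|] satisfies
    [J t <= J (t - 1) + e^(k t) ||g||]. *)

Require Import Defs.
From mathcomp Require Import all_boot all_order all_algebra.
From mathcomp Require Import all_classical all_reals all_analysis.
From mathcomp Require Import measurable_realfun ring lra.
Import Order.TTheory GRing.Theory Num.Theory.
Import numFieldNormedType.Exports.

Local Open Scope classical_set_scope.
Local Open Scope ring_scope.

(** * Almost-everywhere statements and product measures *)

(* [filterS] fails to find the [Filter] instance for [lebesgue_measure]. *)
Lemma ae_sub {d} {T : measurableType d} {R : realType}
    {mu : {measure set T -> \bar R}} {P Q : T -> Prop} :
  (forall x, P x -> Q x) ->
  {ae mu, forall x, P x} -> {ae mu, forall x, Q x}.
Proof. by move=> PQ; apply: filterS. Qed.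

Lemma ae_and {d} {T : measurableType d} {R : realType}
    {mu : {measure set T -> \bar R}} {P Q : T -> Prop} :
  {ae mu, forall x, P x} -> {ae mu, forall x, Q x} ->
  {ae mu, forall x, P x /\ Q x}.
Proof. by move=> hP hQ; apply: filterS2 hP hQ => x. Qed.

(** The measure of an exceptional set is the integral of the measures of its sections, and a
    nonnegative function with zero integral vanishes almost everywhere. *)
Lemma ae_prod_sections1 {d1 d2} {T1 : measurableType d1}
    {T2 : measurableType d2} {R : realType}
    {m1 : {sigma_finite_measure set T1 -> \bar R}}
    {m2 : {sigma_finite_measure set T2 -> \bar R}} {P : T1 * T2 -> Prop} :
  {ae (m1 \x m2)%E, forall p, P p} ->
  {ae m1, forall x, {ae m2, forall y, P (x, y)}}.
Proof.
move=> [N [mN N0 sub]].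
have /(ae_eq_integral_abs m1 measurableT) :
    measurable_fun setT (m2 \o xsection N).
  exact: measurable_fun_xsection.
case=> + _; have -> : (\int[m1]_x `|(m2 \o xsection N) x| = 0)%E.
  by rewrite -N0 /=; apply: eq_integral => x _; rewrite gee0_abs.
move=> /(_ erefl); apply: ae_sub => x /(_ I) /= Nx0.
exists (xsection N x); split => //; first exact: measurable_xsection.
by move=> y /= nP; apply/xsectionP/sub.
Qed.

Lemma ae_prod_sections2 {d1 d2} {T1 : measurableType d1}
    {T2 : measurableType d2} {R : realType}
    {m1 : {sigma_finite_measure set T1 -> \bar R}}
    {m2 : {sigma_finite_measure set T2 -> \bar R}} {P : T1 * T2 -> Prop} :
  {ae (m1 \x m2)%E, forall p, P p} ->
  {ae m2, forall y, {ae m1, forall x, P (x, y)}}.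
Proof.
move=> [N [mN N0 sub]].
(* The product measure slices at a fixed first coordinate; uniqueness of product measures permits
   slicing at a fixed second coordinate instead. *)
have {}N0 : (m1 \x^ m2)%E N = 0%E.
  rewrite -N0; apply/esym; apply: product_measure_unique => // A B mA mB.
  by rewrite /= product_measure2E.
have /(ae_eq_integral_abs m2 measurableT) :
    measurable_fun setT (m1 \o ysection N).
  exact: measurable_fun_ysection.
case=> + _; have -> : (\int[m2]_x `|(m1 \o ysection N) x| = 0)%E.
  by rewrite -N0 /=; apply: eq_integral => x _; rewrite gee0_abs.
move=> /(_ erefl); apply: ae_sub => y /(_ I) /= Ny0.
exists (ysection N y); split => //; first exact: measurable_ysection.
by move=> x /= nP; apply/ysectionP/sub.
Qed.

Lemma ae_prod_fst {d1 d2} {T1 : measurableType d1}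
    {T2 : measurableType d2} {R : realType}
    {m1 : {sigma_finite_measure set T1 -> \bar R}}
    {m2 : {sigma_finite_measure set T2 -> \bar R}} {P : T1 -> Prop} :
  {ae m1, forall x, P x} -> {ae (m1 \x m2)%E, forall p, P p.1}.
Proof.
move=> [N [mN N0 sub]]; exists (N `*` setT); split.
- exact: measurableX.
(* The factor [setT] may have infinite measure; the convention [0 * +oo = 0] settles this case. *)
- by rewrite product_measure1E//= [X in (X * _)%E](N0 : m1 N = 0%E) mul0e.
- by move=> p /= nP; split => //; exact: sub.
Qed.

Lemma le_Rintegral_ae d (T : measurableType d) (R : realType)
    (mu : {measure set T -> \bar R}) (D : set T) (f g : T -> R) :
    measurable D ->
    mu.-integrable D (EFin \o f) -> mu.-integrable D (EFin \o g) ->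
    {ae mu, forall x, D x -> f x <= g x} ->
  \int[mu]_(x in D) f x <= \int[mu]_(x in D) g x.
Proof.
move=> mD fi gi [N [mN N0 sub]].
rewrite /Rintegral (negligible_integral mN mD fi N0).
rewrite (negligible_integral mN mD gi N0).
have mDN : measurable (D `\` N) by exact: measurableD.
have DND : D `\` N `<=` D by exact: subDsetl.
apply: le_Rintegral => //.
- exact: integrableS fi.
- exact: integrableS gi.
move=> x [Dx Nx]; apply/not_notP => H; apply/Nx/sub => /= /(_ Dx); exact: H.
Qed.

(** By Tonelli, the iterated integral of [|e x * h y|] factors into two finite integrals.
    Restricting to [A] gives Fubini integrands on non-rectangular regions. *)
Lemma integrable_prod_restrict {d1 d2} {T1 : measurableType d1}
    {T2 : measurableType d2} {R : realType}
    {m1 : {sigma_finite_measure set T1 -> \bar R}}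
    {m2 : {sigma_finite_measure set T2 -> \bar R}}
    {e : T1 -> R} {h : T2 -> R} {A : set (T1 * T2)} :
  m1.-integrable setT (EFin \o e) -> m2.-integrable setT (EFin \o h) ->
  measurable A ->
  (m1 \x m2)%E.-integrable setT (EFin \o ((fun p => e p.1 * h p.2) \_ A)).
Proof.
move=> ei hi mA.
have me : measurable_fun setT e by apply/measurable_EFinP/(measurable_int _ ei).
have mh : measurable_fun setT h by apply/measurable_EFinP/(measurable_int _ hi).
have mP : measurable_fun setT (fun p : T1 * T2 => e p.1 * h p.2).
  by apply: measurable_funM; apply: measurableT_comp.
rewrite -restrict_EFin; apply/integrable_restrict => //; rewrite setTI.
apply: (@integrableS _ _ _ _ setT) => //.
apply/integrable12ltyP; first exact/measurable_EFinP.
have fin : (\int[m2]_y `|(h y)%:E|)%E \is a fin_num.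
  have [_] := integrableP _ _ _ hi.
  by rewrite ge0_fin_numE// integral_ge0.
rewrite (_ : (fun x => _) = fun x =>
    ((fine (\int[m2]_y `|(h y)%:E|))%:E * `|(e x)%:E|)%E); last first.
  apply/funext => x; rewrite fineK// muleC -ge0_integralZl//.
    by apply: eq_integral => y _; rewrite /= normrM EFinM.
  by do 2 apply: measurableT_comp => //.
rewrite ge0_integralZl//.
- by rewrite fineK// lte_mul_pinfty//; [exact: integral_ge0|case/integrableP: ei].
- by do 2 apply: measurableT_comp => //.
- by rewrite fineK// integral_ge0.
Qed.

(** * Integrals with exponential weights over compact intervals *)

Section Gronwall.
Context {R : realType}.
Notation mu := (@lebesgue_measure R).
Implicit Types (a b s t k : R) (f g h theta : R -> R).

Lemma L1_finite_intervals_itv h a b : L1_finite_intervals h -> 0 <= a ->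
  mu.-integrable `[a, b] (EFin \o h).
Proof.
move=> hi a0.
(* Positive whatever the sign of [b], and beyond [b]: the interval []0, T[] with its two null
   endpoints covers [[a, b]]. *)
pose T := Num.max 0 b + 1.
have T0 : 0 < T by rewrite ltr_wpDl// le_max lexx.
have bT : b < T by rewrite ltr_pwDr// le_max lexx orbT.
apply: (@integrableS _ _ _ mu `[0, T]) => //.
  by apply: subset_itv; rewrite bnd_simp// ltW.
have h0T := hi _ T0.
apply/(@negligible_integrable _ (measurableTypeR R) R mu _ [set 0; T]) => //.
- exact: measurableU.
- apply/emeasurable_fun_itv_bndo_bndcP/emeasurable_fun_itv_obnd_cbndP.
  exact: measurable_int h0T.
- by apply: null_set_setU => //; exact: lebesgue_measure_set1.
- apply: integrableS h0T => //; first exact/measurableD/measurableU.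
  move=> x [/=]; rewrite !in_itv/= => /andP[x0 xT] /not_orP[/eqP nx0 /eqP nxT].
  by rewrite !lt_neqAle x0 xT nxT eq_sym nx0.
Qed.

Lemma continuous_expRM k : continuous (fun x : R => expR (k * x)).
Proof.
move=> x; apply: continuous_comp; last exact: continuous_expR.
exact: mulrl_continuous.
Qed.

Lemma integrable_mul_expRM k a b :
  mu.-integrable `[a, b] (EFin \o (fun x => k * expR (k * x))).
Proof.
apply: continuous_compact_integrable; first exact: segment_compact.
apply: continuous_subspaceT => x; apply: cvgM; first exact: cvg_cst.
exact: continuous_expRM.
Qed.

Lemma ae_neq a : {ae mu, forall x, x != a}.
Proof.
exists [set a]; split; [exact: measurable_set1|exact: lebesgue_measure_set1|].
by move=> x /= /negP; rewrite negbK => /eqP.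
Qed.

(** The weight is continuous, hence bounded on a compact interval. *)
Lemma integrable_expRM k a b h : mu.-integrable `[a, b] (EFin \o h) ->
  mu.-integrable `[a, b] (EFin \o (fun x => expR (k * x) * h x)).
Proof.
move=> hi.
have mE : measurable_fun `[a, b] (fun x : R => expR (k * x)).
  apply: measurable_funTS; apply: continuous_measurable_fun.
  exact: continuous_expRM.
apply: (@integrableMr _ (measurableTypeR R) R mu `[a, b] _
  (fun x => expR (k * x)) (EFin \o h)) => //.
have cE : {within `[a, b], continuous (fun x : R => expR (k * x))}.
  by apply: continuous_subspaceT; exact: continuous_expRM.
have /compact_bounded := continuous_compact cE (@segment_compact _ a b).
move=> [M [_ mrt]]; exists M; split; rewrite ?num_real // => y My x xab /=.
by apply: (mrt y My); exists x.
Qed.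

Lemma Rintegral_expRM k a b : a <= b ->
  \int[mu]_(x in `[a, b]) (k * expR (k * x)) = expR (k * b) - expR (k * a).
Proof.
rewrite le_eqVlt => /predU1P[->|ab].
  by rewrite set_itv1 Rintegral_set1 subrr.
rewrite /Rintegral (@continuous_FTC2 _ _ (fun x => expR (k * x)))//.
- apply: continuous_subspaceT => x; apply: cvgM; first exact: cvg_cst.
  exact: continuous_expRM.
- split.
  + by move=> x _; exact: ex_derive.
  + by apply: cvg_at_right_filter; exact: continuous_expRM.
  + by apply: cvg_at_left_filter; exact: continuous_expRM.
- move=> x _; rewrite derive1_comp// derive1Ml// derive1_id mulr1 derive1E.
  have /funeqP -> := @derive_expR R.
  exact: mulrC.
Qed.

(** Fubini on the triangle [s <= x <= y <= t]: at fixed [y] the weight integrates over [[s, y]] to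
    [expR (k * y) - expR (k * s)]. *)
Lemma Rintegral_expRM_tail k s t h :
    mu.-integrable `[s, t] (EFin \o h) ->
  let tail x := k * expR (k * x) * \int[mu]_(y in `[x, t]) h y in
  mu.-integrable `[s, t] (EFin \o tail) /\
  \int[mu]_(x in `[s, t]) tail x =
  \int[mu]_(x in `[s, t]) ((expR (k * x) - expR (k * s)) * h x).
Proof.
move=> hi tail.
pose RM : measurableType _ := measurableTypeR R.
(* The cut-offs of [e] and [h0] to [[s, t]] reduce this half-plane to the triangle. *)
pose A : set (RM * RM) := [set p | p.1 <= p.2].
have mA : measurable A.
  rewrite /A -[X in measurable X]setTI.
  exact: (@measurable_fun_le _ _ R setT fst snd).
pose e : RM -> R := (fun x => k * expR (k * x)) \_ `[s, t].
pose h0 : RM -> R := h \_ `[s, t].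
have ei : mu.-integrable setT (EFin \o e).
  rewrite -restrict_EFin; apply/integrable_restrict => //; rewrite setTI.
  exact: integrable_mul_expRM.
have h0i : mu.-integrable setT (EFin \o h0).
  by rewrite -restrict_EFin; apply/integrable_restrict => //; rewrite setTI.
have := integrable_prod_restrict ei h0i mA.
set P := EFin \o _ => Pi.
have PE x y : P (x, y) =
    if [&& s <= x, x <= y & y <= t] then (k * expR (k * x) * h y)%:E else 0%E.
  rewrite /P /= patchE; case: ifPn => [/set_mem|/negP] /= xy; last first.
    case: ifPn => // /and3P[_ xy' _]; exfalso; exact/xy/mem_set.
  rewrite /e /h0 !patchE !mem_setE !in_itv /= (xy : x <= y) /=.
  have [sx|sx] /= := leP s x; last by rewrite mul0r.
  rewrite (le_trans sx xy) /=.
  have [yt|yt] /= := leP y t; last by rewrite mulr0.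
  by rewrite (le_trans xy yt).
have hxt x : s <= x -> mu.-integrable `[x, t] (EFin \o h).
  by move=> sx; apply: integrableS hi => //; apply: subset_itvr; rewrite bnd_simp.
have FE : fubini_F mu P = (EFin \o tail) \_ `[s, t].
  apply/funext => x; rewrite /fubini_F patchE mem_setE in_itv /=.
  under eq_integral => y _ do rewrite PE.
  have [sx|sx] /= := leP s x; last by rewrite integral0.
  rewrite (_ : (fun y => _) =
      (fun y => (k * expR (k * x))%:E * (h y)%:E)%E \_ `[x, t]).
    rewrite -integral_mkcond integralZl//; last exact: hxt.
    have [xt|xt] := leP x t; last first.
      by rewrite set_itv_ge -?leNgt ?bnd_simp// integral_set0 mule0.
    rewrite /tail /= [RHS]EFinM fineK//.
    by apply: integrable_fin_num => //; exact: hxt.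
  by apply/funext => y; rewrite patchE mem_setE in_itv /= EFinM.
have GE : fubini_G mu P =
    (EFin \o (fun y => (expR (k * y) - expR (k * s)) * h y)) \_ `[s, t].
  apply/funext => y; rewrite /fubini_G patchE mem_setE in_itv /=.
  under eq_integral => x _ do rewrite PE.
  rewrite [in RHS]andbC.
  have [yt|yt] /= := leP y t; last first.
    by rewrite integral0_eq// => x _; rewrite !andbF.
  rewrite (_ : (fun x => _) =
      (fun x => (k * expR (k * x))%:E * (h y)%:E)%E \_ `[s, y]).
    rewrite -integral_mkcond.
    have Ei : mu.-integrable `[s, y] (EFin \o (fun x => k * expR (k * x))).
      exact: integrable_mul_expRM.
    rewrite integralZr//.
    have [sy|sy] := leP s y; last first.
      by rewrite set_itv_ge -?leNgt ?bnd_simp// integral_set0 mul0e.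
    rewrite /= -Rintegral_expRM// [RHS]EFinM fineK//.
    exact: integrable_fin_num.
  by apply/funext => x; rewrite patchE mem_setE in_itv /= andbT EFinM.
split.
  have := integrable_fubini_F Pi; rewrite FE.
  by move/(integrable_restrict _ _ measurableT); rewrite setTI; apply.
have := Fubini Pi.
rewrite [X in X = _ -> _](_ : _ = (\int[mu]_x (fubini_F mu P x)))%E//.
rewrite [X in _ = X -> _](_ : _ = (\int[mu]_x (fubini_G mu P x)))%E//.
by rewrite FE GE -!integral_mkcond /Rintegral => ->.
Qed.

(** * From the integral inequality to the exponential bound *)

Lemma Rintegral_expRB k s t h : mu.-integrable `[s, t] (EFin \o h) ->
  \int[mu]_(x in `[s, t]) (expR (- k * (t - x)) * h x) =
  expR (- (k * t)) * \int[mu]_(x in `[s, t]) (expR (k * x) * h x).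
Proof.
move=> hi; rewrite -RintegralZl//; last exact: integrable_expRM.
apply: eq_Rintegral => x _; rewrite mulrA -expRD; congr (expR _ * _); ring.
Qed.

Lemma Rintegral_itv_split a b c h : a <= b -> b <= c ->
    mu.-integrable `[a, c] (EFin \o h) ->
  \int[mu]_(x in `[a, c]) h x =
  \int[mu]_(x in `[a, b]) h x + \int[mu]_(x in `[b, c]) h x.
Proof.
move=> ab bc hi.
have := Rintegral_itvB hi
  (_ : (BLeft a <= BRight b)%O) (_ : (BRight b <= BRight c)%O).
rewrite !bnd_simp => /(_ ab bc).
rewrite Rintegral_itv_obnd_cbnd; last first.
  by apply: integrableS hi => //; apply: subset_itvr; rewrite bnd_simp.
lra.
Qed.

(** The integrals of [theta] over [[0, s]] cancel, which leaves a condition on [[s, t]] alone. *)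
Lemma integral_ineqE k s t theta f : 0 <= s -> s <= t ->
    mu.-integrable `[0, t] (EFin \o theta) ->
    mu.-integrable `[0, t] (EFin \o f) ->
  integral_ineq k theta f t s <->
  theta t <= theta s + \int[mu]_(x in `[s, t]) (f x - k * theta x).
Proof.
move=> s0 st thi fi; rewrite /integral_ineq.
have st0 : `[s, t] `<=` `[0, t] by apply: subset_itvr; rewrite bnd_simp.
have thst : mu.-integrable `[s, t] (EFin \o theta) by exact: integrableS thi.
have fst_ : mu.-integrable `[s, t] (EFin \o f) by exact: integrableS fi.
have kthst : mu.-integrable `[s, t] (EFin \o (fun x => k * theta x)).
  exact: (integrableZl _ k thst).
rewrite RintegralB// RintegralZl//.
rewrite (Rintegral_itv_split 0 s t theta)//; split; lra.
Qed.

(** The inequality at [s] itself is a separate hypothesis: an almost-everywhere statement says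
    nothing about one point, and the term in [theta s] comes from there. *)
Lemma gronwall_of_integrated k s t theta f : 0 <= k -> s <= t ->
    mu.-integrable `[s, t] (EFin \o theta) ->
    mu.-integrable `[s, t] (EFin \o f) ->
    theta t <= theta s + \int[mu]_(x in `[s, t]) (f x - k * theta x) ->
    {ae mu, forall x, `[s, t]%classic x ->
      theta t <= theta x + \int[mu]_(y in `[x, t]) (f y - k * theta y)} ->
  gronwall_ineq k theta f t s.
Proof.
move=> k0 st thi fi; set h := fun x => f x - k * theta x => hs hx.
have hi : mu.-integrable `[s, t] (EFin \o h).
  exact: (integrableB _ fi (integrableZl _ k thi)).
have [taili tailE] := Rintegral_expRM_tail k s t h hi.
have Ethi := integrable_expRM k s t theta thi.
have Efi := integrable_expRM k s t f fi.
have Ehi := integrable_expRM k s t h hi.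
have Ei := integrable_mul_expRM k s t.
have kEthi : mu.-integrable `[s, t]
    (EFin \o (fun x => k * (expR (k * x) * theta x))).
  exact: (integrableZl _ k Ethi).
have hEi : mu.-integrable `[s, t] (EFin \o (fun x => expR (k * s) * h x)).
  exact: (integrableZl _ (expR (k * s)) hi).
have : \int[mu]_(x in `[s, t]) (k * expR (k * x) * theta t) <=
    \int[mu]_(x in `[s, t]) (k * (expR (k * x) * theta x) +
      k * expR (k * x) * \int[mu]_(y in `[x, t]) h y).
  apply: le_Rintegral_ae => //.
  - exact: (integrableZr _ (theta t) Ei).
  - exact: (integrableD _ kEthi taili).
  - apply: ae_sub hx => x + xst => /(_ xst) hx.
    have := ler_wpM2l (mulr_ge0 k0 (expR_ge0 (k * x))) hx.
    by rewrite mulrDr !mulrA.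
rewrite RintegralZr// Rintegral_expRM// RintegralD//.
rewrite tailE RintegralZl//.
under [X in _ <= _ + X -> _]eq_Rintegral => x _ do rewrite mulrBl.
rewrite RintegralB// RintegralZl//.
have -> : \int[mu]_(x in `[s, t]) (expR (k * x) * h x) =
    \int[mu]_(x in `[s, t]) (expR (k * x) * f x) -
    k * \int[mu]_(x in `[s, t]) (expR (k * x) * theta x).
  rewrite -RintegralZl// -RintegralB//.
  by apply: eq_Rintegral => x _; rewrite /h; ring.
have := ler_wpM2l (expR_ge0 (k * s)) hs.
rewrite /gronwall_ineq Rintegral_expRB//.
rewrite (_ : expR (- k * (t - s)) = expR (- (k * t)) * expR (k * s)); last first.
  by rewrite -expRD; congr expR; ring.
(* [H1] is the inequality at [s] times [expR (k * s)], [H2] the integrated one. In their sum the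
   left sides add up to [expR (k * t) * theta t], and the integrals of [h] against [expR (k * s)]
   cancel. *)
move=> H1 H2.
rewrite -(ler_pM2l (expR_gt0 (k * t))) mulrDr.
rewrite (mulrC (theta s)) !mulrA -expRD subrr expR0 !mul1r.
move: H1 H2; lra.
Qed.

(** * Lower semicontinuity: from almost every [t] to every [t] *)

(* A null set contains no right neighbourhood of [t], not even when [t = s]. *)
Lemma lsc_le_of_ae s t c theta h : 0 <= s -> s <= t -> lsc_half_line theta ->
    mu.-integrable `[s, t + 1] (EFin \o h) ->
    {ae mu, forall x, s <= x -> theta x <= c + \int[mu]_(y in `[s, x]) h y} ->
  theta t <= c + \int[mu]_(y in `[s, t]) h y.
Proof.
move=> s0 st lsc hi hae; rewrite leNgt; apply/negP => lt_t.
(* The midpoint [a] separates the two sides near [t]: [theta] stays above it by lower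
   semicontinuity, the right side below it by continuity of the primitive. *)
have [] := midf_lt lt_t; set a := _ / 2 => lt_a a_lt.
have t0 : 0 <= t by exact: le_trans st.
have := lsc t a; rewrite /= lte_fin => /(_ a_lt)[V Vt Va].
have {}Vt : \forall x \near t, `[0, +oo[%classic x -> V x.
  have t0oo : `[0, +oo[%classic t by rewrite /= in_itv /= t0.
  by have := nbhs_subspace_in t0oo => E; rewrite /nbhs /= -E in Vt.
have st1 : s <= t + 1 by rewrite (le_trans st)// lerDl.
have It : \forall x \near t, `[s, t + 1]%classic x ->
    \int[mu]_(y in `[s, x]) h y < a - c.
  have /subspace_continuousP/(_ t) := parameterized_integral_continuous st1 hi.
  rewrite /= in_itv /= st lerDl ler01 => /(_ isT) /cvgr_lt/(_ (a - c)).
  by rewrite ltrBrDl; exact.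
have [e /= e0 near_t] : \forall x \near t,
    (`[0, +oo[%classic x -> V x) /\
    (`[s, t + 1]%classic x -> \int[mu]_(y in `[s, x]) h y < a - c).
  exact: filterI Vt It.
(* The cap 1 keeps []t, t + d[] inside [[s, t + 1]], where [h] is known to be integrable. *)
pose d := Num.min e 1.
have d0 : 0 < d by rewrite lt_min e0 ltr01.
(* Every point of this interval violates the almost-everywhere inequality, yet its length [d] is
   positive. *)
have neg : mu.-negligible `]t, t + d[.
  apply: negligibleS hae => x /=; rewrite in_itv /= => /andP[tx].
  rewrite -ltrBlDl lt_min => /andP[xe x1] hx.
  have [] := near_t x; first by rewrite /ball /= distrC gtr0_norm ?subr_gt0.
  rewrite /= !in_itv /= andbT => /(_ (ltW (le_lt_trans t0 tx)))/Va.
  rewrite lte_fin => ax.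
  have sx : s <= x := ltW (le_lt_trans st tx).
  rewrite sx -lerBlDl (ltW x1) => /(_ isT) xa.
  by have := hx sx; lra.
have : mu `]t, t + d[ = 0%E by exact: measure_negligible.
rewrite lebesgue_measure_itv /= lte_fin ltrDl d0 -EFinD => /eqP.
by rewrite eqe addrC addKr gt_eqF.
Qed.

Lemma gronwall_of_integral_ineq k s t theta f : 0 <= k -> 0 <= s -> s <= t ->
    L1_finite_intervals theta -> L1_finite_intervals f ->
    integral_ineq k theta f t s ->
    {ae mu, forall x, s <= x -> x <= t -> integral_ineq k theta f t x} ->
  gronwall_ineq k theta f t s.
Proof.
move=> k0 s0 st thL1 fL1 hs hx.
have thi := L1_finite_intervals_itv theta 0 t thL1 (lexx 0).
have fi := L1_finite_intervals_itv f 0 t fL1 (lexx 0).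
apply: gronwall_of_integrated => //.
- exact: L1_finite_intervals_itv.
- exact: L1_finite_intervals_itv.
- exact/integral_ineqE.
- apply: ae_sub hx => x hx; rewrite /= in_itv => /andP[sx xt].
  by apply/integral_ineqE => //; [exact: le_trans sx|exact: hx].
Qed.

(** * Translation bounded functions *)

Lemma L1_tb_integrable g a b : L1_tb g -> 0 <= a ->
  mu.-integrable `[a, b] (EFin \o g).
Proof.
move=> [gloc _] a0; apply: gloc; last exact: segment_compact.
by apply: subset_itv; rewrite bnd_simp.
Qed.

Lemma Rintegral_norm_le_L1_tb_norm g a b : L1_tb g -> 0 <= a -> b <= a + 1 ->
  \int[mu]_(x in `[a, b]) `|g x| <= fine (L1_tb_norm g).
Proof.
move=> gtb a0 ba; have [_ gfin] := gtb.
have le_norm : (\int[mu]_(x in `[a, b]) `|g x|%:E <= L1_tb_norm g)%E.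
  apply: (@le_trans _ _ (\int[mu]_(x in `[a, (a + 1)%R]) `|g x|%:E)%E).
    apply: ge0_subset_integral => //.
    - have := L1_tb_integrable g a (a + 1) gtb a0.
      by move/integrable_norm/measurable_int.
    - by apply: subset_itvl; rewrite bnd_simp.
  by apply: ereal_sup_ubound; exists a => //=; rewrite in_itv /= a0.
have int0 : (0 <= \int[mu]_(x in `[a, b]) `|g x|%:E)%E.
  by apply: integral_ge0 => x _; rewrite lee_fin.
apply: fine_le => //; rewrite ge0_fin_numE//.
- exact: le_lt_trans gfin.
- exact: le_trans le_norm.
Qed.

(** With [q = expR (- k)], the constant [C] is the sum of the geometric series of terms [M * q ^ i].
    Its fixed-point equation [M + q * C = C] closes the induction. *)
Lemma Rintegral_expRM_norm_le k g t : 0 < k -> L1_tb g -> 0 <= t ->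
  \int[mu]_(x in `[0, t]) (expR (k * x) * `|g x|) <=
  expR (k * t) * (fine (L1_tb_norm g) / (1 - expR (- k))).
Proof.
move=> k0 gtb; set M := fine _; set C := M / _.
have q1 : expR (- k) < 1 by rewrite -expR0 ltr_expR oppr_lt0.
have CE : M + expR (- k) * C = C.
  by rewrite /C; field; rewrite gt_eqF// subr_gt0.
have gi a b : 0 <= a -> mu.-integrable `[a, b] (EFin \o (fun x => `|g x|)).
  by move=> a0; exact/integrable_norm/L1_tb_integrable.
have M0 : 0 <= M.
  apply: le_trans (Rintegral_norm_le_L1_tb_norm g 0 1 gtb _ _) => //.
    by apply: Rintegral_ge0.
  by rewrite add0r.
have C0 : 0 <= C by rewrite divr_ge0// subr_ge0 ltW.
have window a b : 0 <= a -> a <= b -> b <= a + 1 ->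
    \int[mu]_(x in `[a, b]) (expR (k * x) * `|g x|) <= expR (k * b) * M.
  move=> a0 ab ba; apply: (@le_trans _ _
      (\int[mu]_(x in `[a, b]) (expR (k * b) * `|g x|))).
    apply: le_Rintegral => //.
    - exact: integrable_expRM (gi _ _ a0).
    - exact: (integrableZl _ (expR (k * b)) (gi _ _ a0)).
    - move=> x; rewrite /= in_itv => /andP[_ xb].
      by rewrite ler_wpM2r// ler_expR ler_pM2l.
  rewrite RintegralZl//; last exact: gi.
  by rewrite ler_pM2l ?expR_gt0//; exact: Rintegral_norm_le_L1_tb_norm.
(* The induction runs on an integer upper bound of the real endpoint [u], so that [u - 1] falls
   under the previous case. *)
suff H n u : 0 <= u <= n%:R ->
    \int[mu]_(x in `[0, u]) (expR (k * x) * `|g x|) <= expR (k * u) * C.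
  move=> t0; apply: (H (Num.truncn t).+1); rewrite t0 /= ltW//.
  exact: truncnS_gt.
elim: n u => [|n IHn] u.
  rewrite -eq_le => /eqP <-.
  by rewrite set_itv1 Rintegral_set1 mulr_ge0// expR_ge0.
(* For [u <= 1] a single window starting at 0 suffices, since [M <= C]; otherwise the last unit
   window is split off. *)
move=> /andP[u0 un]; have [u1|/ltW u1] := leP u 1.
  apply: le_trans (window 0 u _ _ _) _ => //; first by rewrite add0r.
  rewrite ler_pM2l ?expR_gt0// -CE lerDl mulr_ge0// expR_ge0.
have v0 : 0 <= u - 1 by rewrite subr_ge0.
have vu : u - 1 <= u by rewrite lerBlDr lerDl.
rewrite (Rintegral_itv_split 0 (u - 1) u)//; last exact/integrable_expRM/gi.
have /IHn H1 : 0 <= u - 1 <= n%:R by rewrite v0 lerBlDr natr1.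
have H2 := window (u - 1) u v0 vu; rewrite subrK in H2.
apply: le_trans (lerD H1 (H2 (lexx u))) _.
(* Moving the endpoint back by 1 costs the factor [expR (- k)], which is the [q] of the fixed-point
   equation. *)
rewrite (mulrBr k) mulr1 expRD -mulrA addrC -[X in _ <= _ * X]CE.
by rewrite -mulrDr.
Qed.

End Gronwall.

(** * Assembly of the almost-everywhere and pointwise conclusions *)

Theorem lemma1 (R : realType) (k : R) (theta f : R -> R)
    (k_ge0 : 0 <= k)
    (theta_L1 : L1_finite_intervals theta)
    (f_L1 : L1_finite_intervals f)
    (theta_f : ae_ordered_pairs (integral_ineq k theta f)) :
  ae_ordered_pairs (gronwall_ineq k theta f)
  /\ (lsc_half_line theta ->
      every_t_ae_s (integral_ineq k theta f)
      /\ every_t_ae_s (gronwall_ineq k theta f)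
      /\ ((forall t : R, 0 <= t -> integral_ineq k theta f t 0) ->
          (forall t : R, 0 <= t ->
             theta t <= theta 0 * expR (- k * t)
               + \int[lebesgue_measure]_(x in `[0, t])
                   (expR (- k * (t - x)) * f x))
          /\ (forall (l : R) (g : R -> R),
                0 < k -> 0 <= l -> L1_tb g ->
                {ae @lebesgue_measure R, forall t : R, 0 < t -> f t = l + g t} ->
                forall t : R, 0 <= t ->
                  theta t <= theta 0 * expR (- k * t) + l / k
                    + fine (L1_tb_norm g) / (1 - expR (- k))))).
Proof.
have hi s t : 0 <= s -> lebesgue_measure.-integrable `[s, t]
    (EFin \o (fun x => f x - k * theta x)).
  move=> s0; have fi := L1_finite_intervals_itv f s t f_L1 s0.
  have thi := L1_finite_intervals_itv theta s t theta_L1 s0.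
  exact: (integrableB _ fi (integrableZl _ k thi)).
split.
  (* For almost every pair [(t, s)], the pair itself is good and [t] is also good with almost every
     [x]. *)
  have := ae_and theta_f (ae_prod_fst (ae_prod_sections1 theta_f)).
  apply: ae_sub => -[t s] /= [hts hx] s0 st.
  apply: gronwall_of_integral_ineq => //; [exact: ltW|exact: hts|].
  by apply: ae_sub hx => x hx sx xt; apply: hx => //; exact: lt_le_trans sx.
move=> lsc.
have every : every_t_ae_s (integral_ineq k theta f).
  (* Here [s] is frozen outside a null set first, and semicontinuity then upgrades almost every [t]
     to every [t]. *)
  have := ae_prod_sections2 theta_f; apply: ae_sub => s /= hs s0 t st.
  have t0 : 0 <= t by rewrite (le_trans (ltW s0)).
  apply/integral_ineqE => //; try exact: L1_finite_intervals_itv; first exact: ltW.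
  apply: lsc_le_of_ae => //; [exact: ltW|exact/hi/ltW|].
  apply: ae_sub hs => x /= hx sx.
  apply/integral_ineqE => //; try exact: L1_finite_intervals_itv; first exact: ltW.
  exact: hx.
split => //; split.
  apply: ae_sub (every) => s hs s0 t st.
  apply: gronwall_of_integral_ineq => //; [exact: ltW|exact: hs|].
  by apply: ae_sub every => x hx sx xt; apply: hx => //; exact: lt_le_trans sx.
move=> at0.
have from0 t : 0 <= t -> gronwall_ineq k theta f t 0.
  move=> t0; apply: gronwall_of_integral_ineq => //; first exact: at0.
  apply: ae_sub every => x hx x0 xt.
  (* [every] covers only positive [x]; the endpoint [x = 0] is supplied by [at0]. *)
  move: x0; rewrite le_eqVlt => /predU1P[<-|x0]; first exact: at0.
  exact: hx.
split=> [t t0|l g k0 l0 gtb fE t t0].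
  by have := from0 t t0; rewrite /gronwall_ineq subr0.
apply: le_trans (from0 t t0) _; rewrite subr0 -addrA lerD2l.
have fi := L1_finite_intervals_itv f 0 t f_L1 (lexx 0).
rewrite Rintegral_expRB//.
have gi : lebesgue_measure.-integrable `[0, t] (EFin \o (fun x => `|g x|)).
  exact/integrable_norm/L1_tb_integrable.
have Ei := integrable_mul_expRM k 0 t.
have lEi : lebesgue_measure.-integrable `[0, t]
    (* The constant [l] is written as [l / k * k] so that the weight [k * expR (k * x)] has an
       explicit primitive. *)
    (EFin \o (fun x => l / k * (k * expR (k * x)))).
  exact: (integrableZl _ (l / k) Ei).
have le_int : \int[lebesgue_measure]_(x in `[0, t]) (expR (k * x) * f x) <=
    \int[lebesgue_measure]_(x in `[0, t])
      (l / k * (k * expR (k * x)) + expR (k * x) * `|g x|).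
  apply: le_Rintegral_ae => //.
  - exact: integrable_expRM.
  - exact: (integrableD _ lEi (integrable_expRM k 0 t _ gi)).
  - have := ae_and fE (ae_neq 0).
    apply: ae_sub => x [+ x0]; rewrite /= in_itv /= => + /andP[x0' xt].
    rewrite lt_neqAle eq_sym x0 => /(_ x0') ->.
    rewrite mulrA divfK ?gt_eqF// mulrDr (mulrC l) lerD2l.
    by rewrite ler_pM2l ?expR_gt0// ler_norm.
have {}le_int := ler_wpM2l (expR_ge0 (- (k * t))) le_int.
apply: le_trans le_int _.
rewrite RintegralD//; last exact: integrable_expRM.
rewrite RintegralZl// Rintegral_expRM// mulr0 expR0 mulrDr lerD//.
  rewrite mulrCA mulrBr -expRD addNr expR0 mulr1.
  (* The exact contribution of [l] is [l / k * (1 - expR (- (k * t)))]. Bounding it by [l / k] uses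
     [0 <= l]; for negative [l] the final bound fails at [t = 0] with [g = 0]. *)
  by rewrite ler_piMr ?divr_ge0 ?(ltW k0)// gerBl expR_ge0.
rewrite -(ler_pM2l (expR_gt0 (k * t))) mulrA -expRD subrr expR0 mul1r.
exact: Rintegral_expRM_norm_le.
Qed.
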